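(* Let $M$ be an axisymmetric rotating liquid closed drop with mean curvature $2H(x)=ar^2+b$, where $a>0$, $b\ge0$. If $c_0$ is the unique positive root of $x(ax^2+2b)-4=0$, then the volume enclosed by $M$ is less than $\frac43\pi c_0^3$.
   Context: Coordinates of $\mathbb{R}^3$ are $(x_1,x_2,x_3)$, $r=\sqrt{x_1^2+x_2^2}$. An axisymmetric rotating liquid closed drop (with $a>0$, $b\ge0$) is the embedded closed surface of revolution about the $x_3$-axis obtained as follows: for some $u_0\in\mathbb{R}$, let $u$ be the solution of $$\frac{u''}{(1+u'^2)^{3/2}}+\frac1r\,\frac{u'}{\sqrt{1+u'^2}}=ar^2+b,\qquad u(0)=u_0,\quad u'(0)=0,$$ on its maximal interval $[0,c_0)$, where $\frac14c_0(ac_0^2+2b)=1$ ($u$ extends continuously to $c_0$ with $u'\to+\infty$). Rotate the graph of $u$ about the $x_3$-axis and add its reflection about the horizontal plane $x_3=u(c_0)$. With the inward Gauss map, its mean curvature satisfies $2H=ar^2+b$, where $2H$ is the sum of the principal curvatures. *)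

(* Defs.v *)
From HB Require Import structures.
From mathcomp Require Import all_boot all_order all_algebra.
From mathcomp Require Import all_classical all_reals all_analysis.

Set Implicit Arguments.
Unset Strict Implicit.
Unset Printing Implicit Defensive.

Import Order.TTheory GRing.Theory Num.Theory.
Import numFieldNormedType.Exports.

Local Open Scope classical_set_scope.
Local Open Scope ring_scope.

(* A point (x1, x2, x3) of R^3 is [((x1, x2), x3) : R * R * R]. *)

Section Space.
Context {R : realType}.

Definition axis_dist (p : R * R * R) : R :=
  Num.sqrt (p.1.1 ^+ 2 + p.1.2 ^+ 2).

Definition reflect_horizontal (h : R) (p : R * R * R) : R * R * R :=
  (p.1, 2 * h - p.2).

(* Points off [M] whose connected component in the complement of [M] is
   bounded; for an embedded closed surface, the inside of [M]. *)
Definition enclosed_region (M : set (R * R * R)) : set (R * R * R) :=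
  [set p | ~ M p /\ bounded_set (connected_component (~` M) p)].

Definition enclosed_volume (M : set (R * R * R)) : \bar R :=
  ((@lebesgue_measure R \x @lebesgue_measure R) \x @lebesgue_measure R)%E
    (enclosed_region M).

End Space.

Section Drop.
Context {R : realType}.

(* Twice the mean curvature, at distance [r] from the axis, of the graph of
   [u] rotated about the x3-axis, for the upward normal; on the lower half of
   the drop this is the inward normal. *)
Definition rotated_graph_2H (u : R -> R) (r : R) : R :=
  derive1 (derive1 u) r / (1 + (derive1 u r) ^+ 2) `^ (3 / 2)
  + r^-1 * (derive1 u r / Num.sqrt (1 + (derive1 u r) ^+ 2)).

(* The initial value problem on [0, c[.  Profiles are total functions of
   which only the values on [0, c[ matter: at 0 the derivative is one-sided,
   and the equation, singular there, is imposed on ]0, c[. *)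
Definition profile_solution (a b u0 c : R) (u : R -> R) : Prop :=
  [/\ u 0 = u0,
      h^-1 * (u h - u 0) @[h --> 0^'+] --> (0 : R) &
      forall r : R, 0 < r < c ->
        [/\ derivable u r 1, derivable (derive1 u) r 1 &
            rotated_graph_2H u r = a * r ^+ 2 + b]].

Definition maximal_profile (a b u0 c : R) (u : R -> R) : Prop :=
  profile_solution a b u0 c u /\
  forall (c' : R) (w : R -> R), c < c' -> profile_solution a b u0 c' w ->
    ~ (forall r : R, 0 <= r < c -> w r = u r).

Definition rotated_graph (c : R) (u : R -> R) : set (R * R * R) :=
  [set p | axis_dist p <= c /\ p.2 = u (axis_dist p)].

(* [u c] is the value of the continuous extension of the profile to [0, c]. *)
Definition axisymmetric_closed_drop (a b : R) (M : set (R * R * R)) : Prop :=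
  exists (u0 c : R) (u : R -> R),
    [/\ 0 < c,
        maximal_profile a b u0 c u,
        u r @[r --> c^'-] --> u c,
        derive1 u r @[r --> c^'-] --> +oo &
        M = rotated_graph c u `|`
            reflect_horizontal (u c) @` rotated_graph c u].

End Drop.

(* Main.v *)
Require Import Defs.
From HB Require Import structures.
From mathcomp Require Import all_boot all_order all_algebra.
From mathcomp Require Import all_classical all_reals all_analysis.
From mathcomp Require Import measurable_realfun.
From mathcomp Require Import ring lra.

Import Order.TTheory GRing.Theory Num.Theory.
Import numFieldNormedType.Exports.

Local Open Scope classical_set_scope.
Local Open Scope ring_scope.

(** Apart from its widest circle, the drop is inside the open ball of radius
    [c0] centred at the point of the axis at the height of that circle.

    Write [sin_slope (u' r)] for the sine of the angle between the profile and
    the horizontal.  The left-hand side of the mean curvature equation is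
    [r^-1 * (r * sin_slope (u' r))'], so the equation integrates once
    ([first_integral]):
    [sin_slope (u' r) = r * (a * r ^+ 2 + 2 * b) / 4].
    Letting [r] tend to the end [c] of the interval, where [u'] blows up, makes
    the right-hand side equal to 1 at [c] ([rim_equation]); hence [c = c0].
    A sphere of radius [c] has sine [r / c], and since [a > 0] the factor
    [a * r ^+ 2 + 2 * b] increases with [r], so the sine of the drop is smaller
    than that of the sphere for [0 < r < c].  The profile is thus flatter than
    a hemisphere with the same rim, and its depth [u c - u r] below the rim is
    less than [Num.sqrt (c ^+ 2 - r ^+ 2)] ([profile_below_sphere]).

    The drop is the set where the vertical distance to the rim plane equals
    [h (axis_dist p)] for the depth [h]; the region it encloses is the set
    where that distance is smaller ([enclosed_region_lens_surface]).  This
    region is contained in the ball and misses a nonempty open part of it, so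
    its volume is strictly less than that of the ball
    ([lens_volume_lt], [ball_volume]). *)

(** * The first integral of the curvature equation *)

(** The sine of the inclination angle of a line of slope [t]. *)
Definition sin_slope {R : realType} (t : R) : R := t / Num.sqrt (1 + t ^+ 2).

Lemma sin_slope_lt1 {R : realType} (t : R) : `|sin_slope t| < 1.
Proof.
have S0 : 0 < 1 + t ^+ 2 by nra.
rewrite /sin_slope normrM normfV ltr_pdivrMr ?normr_gt0 ?gt_eqF ?sqrtr_gt0//.
rewrite mul1r (ger0_norm (sqrtr_ge0 _)) -sqrtr_sqr ltr_sqrt//; lra.
Qed.

Lemma sin_slope_sqr {R : realType} (t : R) :
  sin_slope t ^+ 2 * (1 + t ^+ 2) = t ^+ 2.
Proof.
have S0 : 0 < 1 + t ^+ 2 by nra.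
by rewrite /sin_slope expr_div_n sqr_sqrtr ?ltW// divfK ?gt_eqF.
Qed.

Lemma is_derive_exprn {R : realType} (n : nat) (x : R) :
  is_derive x 1 (fun y : R => y ^+ n) (n%:R * x ^+ n.-1).
Proof.
rewrite -exprfctE; apply: is_derive_eq (is_deriveX n (is_derive_id x 1)) _.
by rewrite /GRing.scale/= mulr1.
Qed.

(** This derivative turns the meridional curvature
    [u'' / (1 + u' ^+ 2) `^ (3 / 2)] into the derivative of
    [sin_slope (u' r)]. *)
Lemma is_derive_sin_slope {R : realType} (t : R) :
  is_derive t 1 (@sin_slope R) ((1 + t ^+ 2) `^ (3 / 2))^-1.
Proof.
have S0 : 0 < 1 + t ^+ 2 by nra.
set S := Num.sqrt (1 + t ^+ 2).
have Sp : 0 < S by rewrite sqrtr_gt0.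
have SS : S ^+ 2 = 1 + t ^+ 2 by rewrite sqr_sqrtr// ltW.
have dq : is_derive t 1 (fun x : R => 1 + x ^+ 2) (2 * t).
  have h := is_deriveD (is_derive_cst (1 : R) t 1) (is_derive_exprn 2 t).
  by apply: is_derive_eq h _; rewrite add0r.
have dS : is_derive t 1 (fun x : R => Num.sqrt (1 + x ^+ 2)) ((2 * S)^-1 * (2 * t)).
  have h := @is_derive1_comp _ Num.sqrt (fun x : R => 1 + x ^+ 2) t _ _
    (is_derive1_sqrt S0) dq.
  exact: h.
have dV : is_derive t 1 (fun x : R => (Num.sqrt (1 + x ^+ 2))^-1)
   (- S ^- 2 *: ((2 * S)^-1 * (2 * t))).
  apply: is_deriveV => //; exact: lt0r_neq0.
have := @is_deriveM _ _ id (fun x : R => (Num.sqrt (1 + x ^+ 2))^-1) t 1 _ _ (is_derive_id t 1) dV.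
move=> h; apply: is_derive_eq h _.
rewrite (_ : (1 + t ^+ 2) `^ (3 / 2) = S ^+ 3); last first.
  by rewrite -[RHS]powR_mulrn ?ltW// /S -powR12_sqrt ?ltW// -powRrM mulrC.
rewrite /GRing.scale/= -/S.
have -> : (S ^+ 3)^-1 = (S ^+ 2 - t ^+ 2) / S ^+ 3 by rewrite SS addrK mul1r.
by field; rewrite lt0r_neq0.
Qed.

Lemma derive0_cst_oo {R : realType} (f : R -> R) (a b : R) :
  (forall x, a < x < b -> is_derive x 1 f 0) ->
  forall x y, a < x < b -> a < y < b -> f x = f y.
Proof.
move=> df x y; wlog xy : x y / x <= y => [h xab yab|xab yab].
  by have [/h|/ltW/h] := leP x y; [exact|move=> /(_ yab xab)].
have sub z : z \in `[x, y] -> a < z < b.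
  rewrite in_itv/= => /andP[xz zy]; move: xab yab => /andP[ax _] /andP[_ yb].
  by rewrite (lt_le_trans ax xz) (le_lt_trans zy yb).
have [||z _] := @MVT_segment R f (fun=> 0) x y xy.
- by move=> z zxy; apply/df/sub; exact: subset_itv_oo_cc.
- by apply: derivable_within_continuous => z /sub /df[].
by rewrite mul0r => /eqP; rewrite subr_eq0 => /eqP ->.
Qed.

(** Multiplied by [r], both sides of the curvature equation are derivatives, so
    [r * sin_slope (u' r)] and the primitive of [r * (a * r ^+ 2 + b)]
    differ by a constant on [0 < r < c].  The constant is 0 because a sine is
    bounded, so that both functions tend to 0 with [r]. *)
Lemma first_integral {R : realType} (a b u0 c : R) (u : R -> R) :
  profile_solution a b u0 c u ->
  forall r, 0 < r < c -> sin_slope (derive1 u r) = r * (a * r ^+ 2 + 2 * b) / 4.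
Proof.
move=> [_ _ sol].
pose f r := r * (r * (a * r ^+ 2 + 2 * b) / 4).
pose g r := r * sin_slope (derive1 u r) - f r.
have dg r : 0 < r < c -> is_derive r 1 g 0.
  move=> rc; have [_ du2 eqn] := sol r rc.
  have r0 : r != 0 by case/andP: rc => /lt0r_neq0.
  have dv : is_derive r 1 (derive1 u) (derive1 (derive1 u) r).
    by rewrite [X in is_derive _ _ _ X]derive1E; exact/derivableP.
  have ds := @is_derive1_comp R (@sin_slope R) (derive1 u) r _ _
    (is_derive_sin_slope (derive1 u r)) dv.
  have dm := @is_deriveM _ _ id _ r 1 _ _ (is_derive_id r 1) ds.
  have df : is_derive r 1 f (a * r ^+ 3 + b * r).
    have -> : f = (a / 4) \*: (fun x : R => x ^+ 4) + (b / 2) \*: (fun x : R => x ^+ 2).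
      by apply/funext => x; rewrite /f !fctE/= /GRing.scale/=; field.
    have h := is_deriveD (is_deriveZ (a / 4) (is_derive_exprn 4 r))
                         (is_deriveZ (b / 2) (is_derive_exprn 2 r)).
    by apply: is_derive_eq h _; rewrite /GRing.scale/=; field.
  have h := is_deriveB dm df.
  apply: is_derive_eq h _.
  have -> : a * r ^+ 3 + b * r = r * (a * r ^+ 2 + b) by ring.
  rewrite -eqn /rotated_graph_2H /GRing.scale/= /sin_slope.
  by set S := Num.sqrt _; set P := _ `^ _; rewrite mulrDr mulVKf//; ring.
move=> r rc.
(* The constant value of [g] is bounded by a function that tends to 0 at 0. *)
suff g0 : g r = 0.
  have r0 : r != 0 by case/andP: rc => /lt0r_neq0.
  by apply: (mulfI r0); apply/eqP; rewrite -subr_eq0; apply/eqP.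
have bound x : 0 < x < c -> `|g r| <= x + `|f x|.
  move=> xc; rewrite (derive0_cst_oo _ _ _ dg _ _ rc xc).
  rewrite (le_trans (ler_normB _ _))// lerD2r normrM.
  have /andP[x0 _] := xc.
  by rewrite (gtr0_norm x0) ler_piMr ?ltW ?sin_slope_lt1.
have lim0 : (x + `|f x|) @[x --> (0 : R)^'+] --> (0 : R).
  have cf : continuous (fun x : R => x + `|f x|).
    move=> x; apply: cvgD; first exact: cvg_id.
    apply: cvg_norm; rewrite /f; apply: cvgM; first exact: cvg_id.
    apply: cvgM; last exact: cvg_cst.
    apply: cvgM; first exact: cvg_id.
    apply: cvgD; last exact: cvg_cst.
    by apply: cvgM; [exact: cvg_cst|exact: exprn_continuous].
  have := cvg_at_right_filter (cf 0).
  by rewrite /f mul0r normr0 addr0.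
apply/eqP; rewrite -normr_le0 -(cvg_lim _ lim0)//.
apply: limr_ge; first by apply/cvg_ex; exists 0.
near=> x; apply: bound; apply/andP; split=> //.
near: x; apply: nbhs_right_lt; case/andP: rc; exact: lt_trans.
Unshelve. all: by end_near. Qed.

(** * Comparison of the profile with a hemisphere *)

Definition hemisphere {R : realType} (c r : R) : R := Num.sqrt (c ^+ 2 - r ^+ 2).

(** A sine is at most 1, which gives one inequality in the limit.  If the limit
    of the sine were less than 1, the slope would stay bounded near [c],
    contrary to the vertical tangent there. *)
Lemma rim_equation {R : realType} (a b u0 c : R) (u : R -> R) :
  0 < a -> 0 <= b -> 0 < c -> profile_solution a b u0 c u ->
  derive1 u r @[r --> c^'-] --> +oo ->
  c * (a * c ^+ 2 + 2 * b) = 4.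
Proof.
move=> a0 b0 c0 sol vy.
pose f r : R := r * (a * r ^+ 2 + 2 * b) / 4.
have sE r : 0 < r < c -> sin_slope (derive1 u r) = f r by exact: first_integral sol r.
have f_ge0 r : 0 <= r -> 0 <= f r.
  by move=> r0; rewrite /f; apply: divr_ge0 => //; apply: mulr_ge0 => //; nra.
have near_c : \forall r \near c^'-, 0 < r < c.
  by near=> r; apply/andP; split.
have fc1 : f c <= 1.
  have lim_f : f r @[r --> c^'-] --> f c.
    apply: cvg_at_left_filter; rewrite /f; apply: cvgM; last exact: cvg_cst.
    apply: cvgM; first exact: cvg_id.
    apply: cvgD; last exact: cvg_cst.
    by apply: cvgM; [exact: cvg_cst|exact: exprn_continuous].
  rewrite -(cvg_lim _ lim_f)//.
  apply: limr_le; first by apply/cvg_ex; exists (f c).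
  apply: filterS near_c => r rc.
  by rewrite -sE// (le_trans (ler_norm _))// ltW// sin_slope_lt1.
suff : f c = 1 by rewrite /f; lra.
apply/eqP; rewrite eq_le fc1 leNgt; apply/negP => fc_lt1.
have fc0 := f_ge0 c (ltW c0).
have D0 : 0 < 1 - f c ^+ 2 by nra.
have [r [/andP[r0 rc] vr]] : exists r, 0 < r < c /\ (1 - f c ^+ 2)^-1 < derive1 u r.
  near (c^'-) => r; exists r; split; first by near: r.
  by near: r; move/cvgryPgt : vy; exact.
have := sin_slope_sqr (derive1 u r); rewrite sE ?r0//.
set v := derive1 u r in vr *; move=> fv.
have frc : f r ^+ 2 <= f c ^+ 2.
  have r2c2 : r ^+ 2 <= c ^+ 2 by rewrite ler_sqr ?nnegrE ltW.
  rewrite ler_sqr ?nnegrE ?f_ge0 ?(ltW r0) ?(ltW c0)// /f ler_pM2r ?invr_gt0//.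
  by apply: ler_pM; nra.
have K1 : 1 <= (1 - f c ^+ 2)^-1 by rewrite invf_ge1//; nra.
have : 1 < v * (1 - f c ^+ 2) by rewrite -ltr_pdivrMr// div1r.
by nra.
Unshelve. all: by end_near. Qed.

(** The right-hand side is the slope at radius [r] of a sphere of radius [c],
    whose inclination has sine [r / c]; the sine is increasing in the slope. *)
Lemma sin_slope_lt_sphere {R : realType} (c r v : R) :
  0 < r < c -> sin_slope v < r / c -> v < r / hemisphere c r.
Proof.
move=> /andP[r0 rc] sv; rewrite ltNge; apply/negP => vW.
have D0 : 0 < c ^+ 2 - r ^+ 2 by nra.
have W0 : 0 < hemisphere c r by rewrite sqrtr_gt0.
have WW : hemisphere c r ^+ 2 = c ^+ 2 - r ^+ 2 by rewrite sqr_sqrtr// ltW.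
rewrite ler_pdivrMr// in vW.
have c0 : 0 < c by lra.
rewrite ltr_pdivlMr// in sv.
have v0 : 0 < v by rewrite -(pmulr_lgt0 _ W0); lra.
have s0 : 0 < sin_slope v by rewrite divr_gt0// sqrtr_gt0; nra.
have := sin_slope_sqr v.
have : r ^+ 2 <= v ^+ 2 * (c ^+ 2 - r ^+ 2) by rewrite -WW -exprMn ler_sqr ?nnegrE; nra.
have : (sin_slope v * c) ^+ 2 < r ^+ 2 by rewrite ltr_sqr ?nnegrE; nra.
set s := sin_slope v; rewrite exprMn => h1 h2 h3.
have : (s ^+ 2 * c ^+ 2) * (1 + v ^+ 2) < r ^+ 2 * (1 + v ^+ 2) by rewrite ltr_pM2r//; nra.
rewrite mulrAC h3; nra.
Qed.

Lemma profile_continuous {R : realType} (a b u0 c : R) (u : R -> R) :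
  0 < c -> profile_solution a b u0 c u -> u r @[r --> c^'-] --> u c ->
  {within `[0, c], continuous u}.
Proof.
move=> c0 [_ du0 sol] uc; apply/continuous_within_itvP => //; split=> //.
- move=> r; rewrite in_itv/= => rc; have [du _ _] := sol r rc.
  exact/differentiable_continuous/derivable1_diffP.
- have h : (r * (r^-1 * (u r - u 0)) + u 0) @[r --> 0^'+] --> (0 * 0 + u 0).
    apply: cvgD; last exact: cvg_cst.
    by apply: cvgM => //; apply: cvg_at_right_filter; exact: cvg_id.
  rewrite mul0r add0r in h.
  apply: cvg_trans h; apply: near_eq_cvg; near=> r.
  by rewrite mulVKf ?subrK// gt_eqF.
Unshelve. all: by end_near. Qed.

(** The sum of the profile and the hemisphere of radius [c] has a negative
    derivative, because the rim equation makes the sine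
    [r * (a * r ^+ 2 + 2 * b) / 4] of the drop less than [r / c].  Hence this
    sum is greater at [r] than at [c], where the hemisphere vanishes. *)
Lemma profile_below_sphere {R : realType} (a b u0 c : R) (u : R -> R) :
  0 < a -> 0 <= b -> 0 < c -> profile_solution a b u0 c u ->
  u r @[r --> c^'-] --> u c -> c * (a * c ^+ 2 + 2 * b) = 4 ->
  forall r, 0 <= r < c -> u c - u r < hemisphere c r.
Proof.
move=> a0 b0 c0 sol uc rim.
pose g r := u r + hemisphere c r.
have dg r : 0 < r < c -> is_derive r 1 g (derive1 u r - r / hemisphere c r).
  move=> rc; have [_ _ /(_ r rc)[du _ _]] := sol.
  have dv : is_derive r 1 u (derive1 u r).
    by rewrite [X in is_derive _ _ _ X]derive1E; exact/derivableP.
  have D0 : 0 < c ^+ 2 - r ^+ 2 by move: rc => /andP[]; nra.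
  have dq : is_derive r 1 (fun x : R => c ^+ 2 - x ^+ 2) (- (2 * r)).
    have h := is_deriveB (is_derive_cst (c ^+ 2) r 1) (is_derive_exprn 2 r).
    by apply: is_derive_eq h _; rewrite sub0r.
  have h := @is_derive1_comp _ Num.sqrt (fun x : R => c ^+ 2 - x ^+ 2) r _ _
    (is_derive1_sqrt D0) dq.
  apply: is_derive_eq (is_deriveD dv h) _; congr (_ + _).
  rewrite /hemisphere; field; rewrite lt0r_neq0// sqrtr_gt0//.
have cg : {within `[0, c], continuous g}.
  move=> x; apply: cvgD; first exact: (profile_continuous _ _ _ _ _ c0 sol uc).
  apply: continuous_subspaceT => {}x.
  apply: continuous_comp; last exact: sqrt_continuous.
  by apply: cvgB; [exact: cvg_cst|exact: exprn_continuous].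
have dlt r : r \in `]0, c[ -> derive1 g r < 0.
  rewrite in_itv/= => rc; have [_ gv] := dg r rc; rewrite derive1E gv subr_lt0.
  apply: sin_slope_lt_sphere => //; rewrite (first_integral _ _ _ _ _ sol)//.
  have /andP[r0 rc'] := rc.
  have h : 0 < c * r * (a * (c ^+ 2 - r ^+ 2)).
    by rewrite !mulr_gt0// subr_gt0 ltr_sqr ?nnegrE ?ltW.
  rewrite ltr_pdivlMr//.
  have : c * (r * (a * r ^+ 2 + 2 * b)) < 4 * r by rewrite -rim; lra.
  by lra.
move=> r /andP[r0 rc].
have := @ltr0_derive1_lt_cc _ g 0 c _ dlt cg c r.
rewrite !in_itv/= lexx (ltW c0) r0 ltW// => /(_ _ isT isT rc).
rewrite /g /hemisphere subrr sqrtr0 addr0 ltrBlDl; apply.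
by move=> x; rewrite in_itv/= => /dg[].
Qed.

Lemma profile_le_rim {R : realType} (a b u0 c : R) (u : R -> R) :
  0 < a -> 0 <= b -> 0 < c -> profile_solution a b u0 c u ->
  u r @[r --> c^'-] --> u c -> forall r, 0 <= r <= c -> u r <= u c.
Proof.
move=> a0 b0 c0 sol uc r /andP[r0 rc].
have [_ _ du] := sol.
apply: (@ger0_derive1_le_cc _ u 0 c) => //; rewrite ?in_itv/= ?r0 ?rc ?lexx ?ltW//.
- by move=> x; rewrite in_itv/= => /du[].
- move=> x; rewrite in_itv/= => xc; have /andP[x0 _] := xc.
  have : 0 <= sin_slope (derive1 u x).
    rewrite (first_integral _ _ _ _ _ sol)//; apply: divr_ge0 => //.
    by apply: mulr_ge0; nra.
  by rewrite /sin_slope pmulr_lge0// invr_gt0 sqrtr_gt0; nra.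
- exact: profile_continuous c0 sol uc.
Qed.

(** * The region enclosed by a lens-shaped surface *)

Definition lens {R : realType} (h : R -> R) (z : R) : set (R * R * R) :=
  [set p | `|p.2 - z| < h (axis_dist p)].

Definition lens_surface {R : realType} (h : R -> R) (z c : R) : set (R * R * R) :=
  [set p | axis_dist p <= c /\ `|p.2 - z| = h (axis_dist p)].

Lemma continuous_axis_dist {R : realType} : continuous (@axis_dist R).
Proof.
move=> p; rewrite /axis_dist.
have c1 : {for p, continuous (fun q : R * R * R => q.1.1)}.
  by apply: (continuous_comp (f := fst) (g := fst)); exact: cvg_fst.
have c2 : {for p, continuous (fun q : R * R * R => q.1.2)}.
  by apply: (continuous_comp (f := fst) (g := snd)); [exact: cvg_fst|exact: cvg_snd].
apply: (continuous_comp (f := fun p : R * R * R => p.1.1 ^+ 2 + p.1.2 ^+ 2)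
  (g := Num.sqrt)); last exact: sqrt_continuous.
apply: cvgD.
  exact: (continuous_comp c1 (@exprn_continuous _ 2 _)).
exact: (continuous_comp c2 (@exprn_continuous _ 2 _)).
Qed.

Lemma axis_dist_ge0 {R : realType} (p : R * R * R) : 0 <= axis_dist p.
Proof. exact: sqrtr_ge0. Qed.

Lemma continuous_lens_gap {R : realType} (h : R -> R) (z : R) :
  continuous h ->
  continuous (fun p : R * R * R => h (axis_dist p) - `|p.2 - z|).
Proof.
move=> ch p; apply: cvgB.
  by apply: (continuous_comp (g := h)); [exact: continuous_axis_dist|exact: ch].
apply: cvg_norm; apply: cvgB; [exact: cvg_snd|exact: cvg_cst].
Qed.

Lemma lens_bounded {R : realType} (h : R -> R) (z c : R) :
  (forall r, c <= r -> h r = 0) -> (forall r, h r <= c) ->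
  forall p, lens h z p -> `|p| <= `|z| + `|c|.
Proof.
move=> h0 hc p pD.
have axis_lt : axis_dist p < c.
  rewrite ltNge; apply/negP => /h0 hp.
  by move: pD; rewrite /lens/= hp normr_lt0.
have dist_le x y : `|x| <= Num.sqrt (x ^+ 2 + y ^+ 2) :> R.
  by rewrite -sqrtr_sqr ler_sqrt ?lerDl ?addr_ge0 ?sqr_ge0.
have c0 : 0 <= c by apply: ltW; exact: le_lt_trans (axis_dist_ge0 p) axis_lt.
have le1 : `|p.1.1| <= c by apply: ltW; exact: le_lt_trans (dist_le _ _) axis_lt.
have le2 : `|p.1.2| <= c.
  by apply: ltW; apply: le_lt_trans axis_lt; rewrite /axis_dist addrC.
have le3 : `|p.2| <= `|z| + c.
  rewrite -[p.2](subrK z) addrC (le_trans (ler_normD _ _))// lerD2l.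
  by apply/ltW/(lt_le_trans pD).
rewrite !prod_normE/= (ger0_norm c0) !ge_max le3.
by have := normr_ge0 z; lra.
Qed.

(** The complement of the surface is the disjoint union of two open sets, the
    lens and its exterior.  Radii beyond [c] are listed separately in the
    exterior because there the plane of height [z], where the gap
    [h (axis_dist q) - `|q.2 - z|] vanishes, is also off the surface. *)
Lemma component_sub_lens {R : realType} (h : R -> R) (z c : R) (p : R * R * R) :
  continuous h -> (forall r, c <= r -> h r = 0) -> lens h z p ->
  connected_component (~` lens_surface h z c) p `<=` lens h z.
Proof.
move=> ch h0 pD.
have pM : (~` lens_surface h z c) p.
  by move=> [_ e]; move: pD; rewrite /lens/= e ltxx.
have cphi := continuous_lens_gap h z ch.
set phi := (fun q : R * R * R => _) in cphi.
set C := connected_component _ p.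
have open_lens : open (lens h z).
  have -> : lens h z = phi @^-1` [set x | 0 < x].
    by apply/seteqP; split=> q; rewrite /lens/phi/= subr_gt0.
  by apply: open_comp; [move=> q _; exact: cphi|exact: open_gt].
have open_out : open (phi @^-1` [set x | x < 0] `|` @axis_dist R @^-1` [set x | c < x]).
  apply: openU; apply: open_comp; first by move=> q _; exact: cphi.
  - exact: open_lt.
  - by move=> q _; exact: continuous_axis_dist.
  - exact: open_gt.
suff -> : C = C `&` lens h z by exact: subIsetr.
apply/esym/(@component_connected _ (~` lens_surface h z c) p).
- by exists p; split => //; exact: connected_component_refl.
- by exists (lens h z).
- exists (~` (phi @^-1` [set x | x < 0] `|` @axis_dist R @^-1` [set x | c < x])).
    exact: open_closedC.
  apply/seteqP; split=> q [qC qD]; split=> //.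
    rewrite /phi/= => -[|]; first by move: qD; rewrite /lens/=; lra.
    by move=> /ltW /h0 e; move: qD; rewrite /lens/= e normr_lt0.
  have qM := connected_component_sub qC.
  rewrite /lens/= ltNge; apply/negP => le_h.
  apply: qD; rewrite /phi/=; have [cq|qc] := ltP c (axis_dist q); first by right.
  left; rewrite subr_lt0 lt_neqAle le_h andbT; apply/negP => /eqP e.
  by apply: qM; split.
Qed.

(** From a point outside the lens the vertical ray that leads away from the plane
    of height [z] never meets the surface: the radius is constant along it and
    the distance to that plane increases. *)
Lemma unbounded_component {R : realType} (h : R -> R) (z c : R) (p : R * R * R) :
  ~ lens_surface h z c p -> ~ lens h z p ->
  ~ bounded_set (connected_component (~` lens_surface h z c) p).
Proof.
move=> pM /negP; rewrite -leNgt => hp bC.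
pose s : R := if z <= p.2 then 1 else -1.
have s1 : s * s = 1 by rewrite /s; case: ifP; lra.
have sp : s * (p.2 - z) = `|p.2 - z|.
  rewrite /s; case: (leP z p.2) => zp; first by rewrite mul1r ger0_norm// subr_ge0.
  by rewrite mulN1r ltr0_norm// subr_lt0.
pose ray t : R * R * R := (p.1, p.2 + s * t).
have cray : continuous ray.
  move=> t; apply: (cvg_pair (F := nbhs t) (G := nbhs p.1) (H := nbhs (p.2 + s * t))).
    exact: cvg_cst.
  by apply: cvgD; [exact: cvg_cst|apply: cvgM; [exact: cvg_cst|exact: cvg_id]].
have ray0 : ray 0 = p by rewrite /ray mulr0 addr0; case: (p).
have ray_z t : 0 <= t -> `|(ray t).2 - z| = `|p.2 - z| + t.
  move=> t0; have -> : (ray t).2 - z = s * (`|p.2 - z| + t).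
    by rewrite -sp mulrDr mulrA s1 mul1r /ray/= addrAC.
  rewrite normrM (_ : `|s| = 1); last by rewrite /s; case: ifP; rewrite ?normrN normr1.
  by rewrite mul1r ger0_norm// addr_ge0.
have sub : ray @` `[0, +oo[ `<=` connected_component (~` lens_surface h z c) p.
  apply: connected_component_max.
  - by exists 0 => //=; rewrite in_itv/= lexx.
  - move=> _ [t + <-]; rewrite /= in_itv/= andbT => t0 [rc].
    rewrite ray_z// /ray => e; apply: pM; split; first exact: rc.
    by apply/eqP; rewrite eq_le hp andbT -[leRHS]e lerDl.
  - apply: connected_continuous_connected; last exact: continuous_subspaceT.
    exact/connected_intervalP/interval_is_interval.
have [K K0 bK] := pinfty_ex_gt0 bC.
pose t := K + `|z| + 1.
have t0 : 0 <= t by rewrite /t; have := normr_ge0 z; lra.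
have rayC : connected_component (~` lens_surface h z c) p (ray t).
  by apply: sub; exists t => //=; rewrite in_itv/= t0.
have := bK _ rayC; rewrite /= prod_normE ge_max => /andP[_ rayK].
have := ray_z t t0; have := ler_normB (ray t).2 z; have := normr_ge0 (p.2 - z).
by rewrite /t; lra.
Qed.

Lemma enclosed_region_lens_surface {R : realType} (h : R -> R) (z c : R) :
  continuous h -> (forall r, c <= r -> h r = 0) -> (forall r, h r <= c) ->
  enclosed_region (lens_surface h z c) = lens h z.
Proof.
move=> ch h0 hc; apply/seteqP; split=> p.
  by move=> [pM bC]; apply: contrapT => pD; exact: unbounded_component pM pD bC.
move=> pD; split; first by move=> [_ e]; move: pD; rewrite /lens/= e ltxx.
exists (`|z| + `|c|); split; first exact: num_real.
move=> K ltK q qC; apply: ltW; apply: le_lt_trans ltK.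
apply: (lens_bounded h z c h0 hc).
exact: (component_sub_lens h z c p ch h0 pD).
Qed.

(** The two points of the drop over a given radius are at signed heights
    [- h] and [h] from the rim plane, so an absolute value describes both
    halves. *)
Lemma drop_eq_lens_surface {R : realType} (c : R) (u h : R -> R) :
  (forall r, 0 <= r <= c -> u r <= u c) ->
  (forall r, 0 <= r <= c -> h r = u c - u r) ->
  rotated_graph c u `|` reflect_horizontal (u c) @` rotated_graph c u
    = lens_surface h (u c) c.
Proof.
move=> ule hE; apply/seteqP; split=> [p|p [pc e]].
- case=> [[pc e]|[q [qc e] <-]].
    have rc : 0 <= axis_dist p <= c by rewrite axis_dist_ge0.
    by split => //; rewrite e hE// distrC ger0_norm// subr_ge0 ule.
  have rc : 0 <= axis_dist q <= c by rewrite axis_dist_ge0.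
  split=> //; rewrite /reflect_horizontal/= -[axis_dist _]/(axis_dist q) hE// e.
  have -> : 2 * u c - u (axis_dist q) - u c = u c - u (axis_dist q) by ring.
  by rewrite ger0_norm// subr_ge0 ule.
have rc : 0 <= axis_dist p <= c by rewrite axis_dist_ge0.
rewrite hE// in e; case: (leP (u c) p.2) => [ge|lt].
- right; exists (p.1, 2 * u c - p.2).
    split=> //; rewrite /= -[axis_dist _]/(axis_dist p).
    by move: e; rewrite ger0_norm ?subr_ge0//; lra.
  by rewrite /reflect_horizontal/=; rewrite opprB addrC subrK -surjective_pairing.
- left; split=> //; move: e; rewrite ltr0_norm ?subr_lt0//; lra.
Qed.

(** Composition with [clamp c] extends a function continuous on [0, c] to a
    continuous function on the line. *)
Definition clamp {R : realType} (c r : R) : R := Num.min c (Num.max 0 r).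

Lemma clamp_itv {R : realType} (c r : R) : 0 <= c -> 0 <= clamp c r <= c.
Proof. by move=> c0; rewrite /clamp le_min c0 le_max lexx/= ge_min lexx. Qed.

Lemma clamp_id {R : realType} (c r : R) : 0 <= r <= c -> clamp c r = r.
Proof. by move=> /andP[r0 rc]; rewrite /clamp max_r// min_r. Qed.

Lemma clamp_ge {R : realType} (c r : R) : c <= r -> clamp c r = c.
Proof. by move=> cr; rewrite /clamp min_l// le_max cr orbT. Qed.

Lemma continuous_clamp_comp {R : realType} (c : R) (f : R -> R) :
  0 <= c -> {within `[0, c], continuous f} -> continuous (f \o clamp c).
Proof.
move=> c0 /subspace_continuousP cf r.
have kc s : `[0, c]%classic (clamp c s) by rewrite /= in_itv/= clamp_itv.
have ck : {for r, continuous (@clamp R c)}.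
  apply: continuous_min; first exact: cvg_cst.
  by apply: continuous_max; [exact: cvg_cst|exact: cvg_id].
move=> B /(cf _ (kc r)) /= wB.
have := ck _ wB; rewrite !near_simpl/=.
by apply: filterS => s /(_ (kc s)).
Qed.

(** * Volumes of lenses and balls *)

Lemma derive_LRcontinuous {R : realType} (F f : R -> R) (a b : R) :
  (forall x : R, is_derive x 1 F (f x)) -> derivable_oo_LRcontinuous F a b.
Proof.
move=> dF; have cF : continuous F.
  by move=> x; apply/differentiable_continuous/derivable1_diffP; case: (dF x).
split; first by move=> x _; case: (dF x).
- by apply: cvg_at_right_filter; exact: cF.
- by apply: cvg_at_left_filter; exact: cF.
Qed.

Lemma integral_derive {R : realType} (F f : R -> R) (a b : R) :
  a < b -> continuous f -> (forall x : R, is_derive x 1 F (f x)) ->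
  (\int[lebesgue_measure]_(x in `[a, b]) (f x)%:E = (F b - F a)%:E)%E.
Proof.
move=> ab cf dF; rewrite (continuous_FTC2 (F := F) ab) ?EFinB//.
- exact: continuous_subspaceT.
- exact: derive_LRcontinuous dF.
- by move=> x _; have [_ h] := dF x; rewrite derive1E.
Qed.

Lemma continuous_hemisphere {R : realType} (c : R) : continuous (hemisphere c).
Proof.
move=> x; apply: (continuous_comp (f := fun x : R => c ^+ 2 - x ^+ 2) (g := Num.sqrt)).
  by apply: cvgB; [exact: cvg_cst|exact: exprn_continuous].
exact: sqrt_continuous.
Qed.

(** The area of a half disk.  The substitution [x = c * sin t] avoids the
    vertical tangents of the integrand at [c] and [- c]. *)
Lemma integral_hemisphere {R : realType} (c : R) : 0 < c ->
  (\int[lebesgue_measure]_(x in `[(- c)%R, c]) (hemisphere c x)%:E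
   = (pi * c ^+ 2 / 2)%:E)%E.
Proof.
move=> c0.
have pi0 : 0 < pi / 2 :> R by rewrite divr_gt0// pi_gt0.
pose F (t : R) := c * sin t.
have dF (t : R) : is_derive t 1 F (c * cos t).
  by have := is_deriveZ c (is_derive_sin t).
have F'E : derive1 F = fun t => c * cos t.
  by apply/funext => t; have [_ h] := dF t; rewrite derive1E.
have cF' : continuous (derive1 F).
  by move=> t; rewrite F'E; apply: cvgM; [exact: cvg_cst|exact: continuous_cos].
have Fl : F (- (pi / 2)) = - c by rewrite /F sinN sin_pihalf mulrN1.
have Fr : F (pi / 2) = c by rewrite /F sin_pihalf mulr1.
have := @integration_by_substitution_increasing R F (hemisphere c) (- (pi / 2)) (pi / 2).
rewrite Fl Fr => -> //; last 1 first.
- exact/continuous_subspaceT/continuous_hemisphere.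
- rewrite (_ : \int[_]_(x in _) _ = \int[lebesgue_measure]_(x in `[(- (pi / 2))%R, (pi / 2)%R])
    (c ^+ 2 * cos x ^+ 2)%:E)%E.
    pose G (t : R) := c ^+ 2 / 2 * (t + sin t * cos t).
    transitivity (G (pi / 2) - G (- (pi / 2)))%:E; last first.
      by rewrite /G cosN sinN cos_pihalf; congr EFin; field.
    apply: integral_derive.
    + by lra.
    + move=> t; apply: cvgM; first exact: cvg_cst.
      exact: (continuous_comp (@continuous_cos _ t) (@exprn_continuous _ 2 _)).
    + move=> t; have h := is_deriveZ (c ^+ 2 / 2)
        (is_deriveD (is_derive_id t 1) (is_deriveM (is_derive_sin t) (is_derive_cos t))).
      apply: is_derive_eq h _; rewrite /GRing.scale/=.
      have := cos2Dsin2 t => e.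
      have -> : 1 + (sin t * - sin t + cos t * cos t) = 2 * cos t ^+ 2.
        by lra.
      by field.
  apply: eq_integral => t; rewrite inE/= in_itv/= => ht; congr EFin.
  rewrite !fctE/= F'E /hemisphere /F.
  have cost : 0 <= cos t by apply: cos_ge0_pihalf.
  have -> : c ^+ 2 - (c * sin t) ^+ 2 = (c * cos t) ^+ 2.
    by rewrite !exprMn sin2cos2; ring.
  rewrite sqrtr_sqr ger0_norm; last by rewrite mulr_ge0// ltW.
  by ring.
- by lra.
- move=> x y xi yi xy; rewrite /F ltr_pM2l// ltr_sin//.
- by apply: cvgP; apply: cvg_at_right_filter; exact: cF'.
- by apply: cvgP; apply: cvg_at_left_filter; exact: cF'.
- exact: derive_LRcontinuous dF.
Qed.

Lemma measurable_lt_fun d (T : measurableType d) (R : realType) (f g : T -> R) :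
  measurable_fun setT f -> measurable_fun setT g ->
  measurable [set x | f x < g x].
Proof.
move=> mf mg; have := measurable_fun_ltr mf mg => /(_ measurableT [set true] I).
by rewrite setTI; congr measurable; apply/seteqP; split=> x /=.
Qed.

(** The integrand is 0 when [k <= 0], whence the maximum; in [ball_volume] such
    [k] come from the plane sections that miss the ball. *)
Lemma integral_sqrt_line {R : realType} (k : R) :
  (\int[lebesgue_measure]_x (Num.sqrt (k - x ^+ 2))%:E
   = (pi * Num.max k 0 / 2)%:E)%E.
Proof.
have [k0|k0] := leP k 0.
  rewrite mulr0 mul0r; apply: integral0_eq => x _.
  by rewrite ler0_sqrtr//; have := sqr_ge0 x; lra.
pose c := Num.sqrt k; have c0 : 0 < c by rewrite sqrtr_gt0.
have cc : c ^+ 2 = k by rewrite sqr_sqrtr// ltW.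
rewrite -cc -integral_hemisphere// [RHS]integral_mkcond.
apply: eq_integral => x _.
rewrite patchE; case: ifPn => //; rewrite notin_setE/= in_itv/= -ler_norml.
move=> /negP; rewrite -ltNge => xc.
rewrite ler0_sqrtr// subr_le0 -[leRHS]real_normK ?num_real//.
by rewrite ler_sqr ?nnegrE ?(ltW xc) ?(ltW c0).
Qed.

Lemma measurable_axis_dist {R : realType} :
  measurable_fun [set: R * R * R] (@axis_dist R).
Proof.
apply: (measurableT_comp (f := @Num.sqrt R)).
  apply: continuous_measurable_fun; exact: sqrt_continuous.
by apply: measurable_funD; apply: measurable_funX; apply: measurableT_comp.
Qed.

Lemma measurable_lens {R : realType} (h : R -> R) (z : R) :
  continuous h -> measurable (lens h z).
Proof.
move=> ch; apply: measurable_lt_fun.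
  apply: measurableT_comp => //; apply: measurable_funB; first exact: measurable_snd.
  exact: measurable_cst.
apply: measurableT_comp; first exact: continuous_measurable_fun.
exact: measurable_axis_dist.
Qed.

(** [lens (hemisphere c) z] is the open ball of radius [c] about the point of
    height [z] on the axis.  Its vertical chords are integrated over the plane,
    one coordinate at a time: the inner integral is a half disk area, the outer
    one that of a polynomial. *)
Lemma ball_volume {R : realType} (z c : R) : 0 < c ->
  (((@lebesgue_measure R \x @lebesgue_measure R) \x @lebesgue_measure R)
    (lens (hemisphere c) z) = (4 / 3 * pi * c ^+ 3)%:E)%E.
Proof.
move=> c0.
(* Where the chord is empty, the square root is that of a negative number. *)
have chord q : lebesgue_measure (xsection (lens (hemisphere c) z) q)
    = (2 * Num.sqrt (c ^+ 2 - q.1 ^+ 2 - q.2 ^+ 2))%:E.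
  set w := Num.sqrt _.
  have -> : xsection (lens (hemisphere c) z) q = (`]z - w, z + w[)%classic.
    have E t : (t \in `]z - w, z + w[) = (`|t - z| < hemisphere c (axis_dist (q, t))).
      rewrite in_itv/= -ltr_distl /hemisphere sqr_sqrtr ?addr_ge0 ?sqr_ge0//=.
      by rewrite opprD addrA.
    apply/seteqP; split=> t /=; rewrite E => h; last exact/xsectionP.
    by move/xsectionP : h.
  have w0 : 0 <= w by exact: sqrtr_ge0.
  rewrite lebesgue_measure_itv/= lte_fin; case: ifPn => [_|].
    by rewrite -EFinB; congr EFin; ring.
  by rewrite -leNgt => h1; congr EFin; lra.
transitivity (\int[(@lebesgue_measure R \x @lebesgue_measure R)%E]_q
    (2 * Num.sqrt (c ^+ 2 - q.1 ^+ 2 - q.2 ^+ 2))%:E)%E.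
  by apply: eq_integral => q _; exact: chord.
have msqrt : measurable_fun [set: R] (@Num.sqrt R).
  by apply: continuous_measurable_fun; exact: sqrt_continuous.
rewrite fubini_tonelli1/=; last 2 first.
- apply/measurable_EFinP; apply: measurable_funM; first exact: measurable_cst.
  apply: (measurableT_comp msqrt).
  by do 2?[apply: measurable_funB]; rewrite //; apply: measurable_funX.
- by move=> q; rewrite lee_fin mulr_ge0// sqrtr_ge0.
pose cap (x : R) := pi * (c ^+ 2 - x ^+ 2).
transitivity (\int[lebesgue_measure]_(x in `[(- c)%R, c]) (cap x)%:E)%E.
  rewrite [RHS]integral_mkcond; apply: eq_integral => x _.
  rewrite /fubini_F/=; under eq_integral do rewrite EFinM.
  rewrite ge0_integralZl//=; last first.
    apply/measurable_EFinP; apply: (measurableT_comp msqrt).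
    by apply: measurable_funB => //; apply: measurable_funX.
  rewrite integral_sqrt_line -EFinM mulrC divfK// /cap patchE.
  case: ifPn; rewrite ?inE ?notin_setE/= in_itv/= -ler_norml => xc.
    rewrite max_l// subr_ge0 -[leLHS]real_normK ?num_real//.
    by rewrite ler_sqr ?nnegrE// ltW.
  rewrite max_r ?mulr0// subr_le0 -[leRHS]real_normK ?num_real//.
  by move/negP: xc; rewrite -ltNge => xc; rewrite ler_sqr ?nnegrE ?(ltW xc) ?(ltW c0).
pose G (x : R) := pi * (c ^+ 2 * x - x ^+ 3 / 3).
transitivity (G c - G (- c))%:E; last by rewrite /G; congr EFin; field.
apply: integral_derive; first by lra.
- move=> x; apply: cvgM; first exact: cvg_cst.
  by apply: cvgB; [exact: cvg_cst|exact: exprn_continuous].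
move=> x.
have h := is_deriveZ pi (is_deriveB (is_deriveZ (c ^+ 2) (is_derive_id x 1))
  (is_deriveZ 3^-1 (is_derive_exprn 3 x))).
have -> : G = pi \*: (c ^+ 2 \*: id - 3^-1 \*: (fun y : R => y ^+ 3)).
  by apply/funext => y; rewrite /G !fctE/= /GRing.scale/=; field.
by apply: is_derive_eq h _; rewrite /GRing.scale/= /cap; field.
Qed.

(** The source of strictness: a nonempty open set carries positive volume. *)
Lemma open_contains_box {R : realType} (U : set (R * R * R)) :
  open U -> U !=set0 -> exists A, [/\ measurable A, A `<=` U &
    (0 < ((@lebesgue_measure R \x @lebesgue_measure R) \x @lebesgue_measure R) A)%E].
Proof.
move=> oU [p Up].
have /nbhs_ballP[e e0 sub] : nbhs p U by exact: open_nbhs_nbhs.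
rewrite /= in e0.
pose B (x : R) : set R := ball x e.
have mB x : measurable (B x) by exact: measurable_ball.
have B0 x : (0 < lebesgue_measure (B x))%E.
  by rewrite lebesgue_measure_ball ?ltW// lte_fin mulrn_wgt0.
exists ((B p.1.1 `*` B p.1.2) `*` B p.2); split.
- by apply: measurableX; first exact: measurableX.
- by move=> q [[q1 q2] q3]; apply: sub; split.
rewrite (product_measure1E (@lebesgue_measure R \x @lebesgue_measure R)%E
  lebesgue_measure (measurableX (mB _) (mB _)) (mB _)).
rewrite [X in (0 < X * _)%E](product_measure1E lebesgue_measure lebesgue_measure
  (mB _) (mB _)).
by apply: mule_gt0; [apply: mule_gt0|]; exact: B0.
Qed.

(** On the axis the depth [h 0] is less than [c], so a point at a height between
    the two is in the ball and outside the closed lens; by continuity a whole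
    neighbourhood of it is. *)
Lemma lens_volume_lt {R : realType} (h : R -> R) (z c : R) :
  0 < c -> continuous h -> (forall r, c <= r -> h r = 0) ->
  (forall r, 0 <= r < c -> h r < hemisphere c r) ->
  (((@lebesgue_measure R \x @lebesgue_measure R) \x @lebesgue_measure R)
    (lens h z) < (4 / 3 * pi * c ^+ 3)%:E)%E.
Proof.
move=> c0 ch h0 hlt.
set mu := (_ \x _)%E.
have hE0 : hemisphere c 0 = c by rewrite /hemisphere expr0n/= subr0 sqrtr_sqr gtr0_norm.
have h0c : h 0 < c by rewrite -[ltRHS]hE0 hlt// lexx.
have sub : lens h z `<=` lens (hemisphere c) z.
  move=> p; rewrite /lens/= => ph; apply: (lt_trans ph); apply: hlt.
  rewrite axis_dist_ge0 ltNge; apply/negP => /h0 e.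
  by move: ph; rewrite e normr_lt0.
pose phi g (p : R * R * R) : R := g (axis_dist p) - `|p.2 - z|.
pose U := phi h @^-1` [set x | x < 0] `&` phi (hemisphere c) @^-1` [set x | 0 < x].
have oU : open U.
  apply: openI; apply: open_comp.
  - by move=> p _; exact: continuous_lens_gap.
  - exact: open_lt.
  - by move=> p _; apply: continuous_lens_gap; exact: continuous_hemisphere.
  - exact: open_gt.
pose m := (Num.max 0 (h 0) + c) / 2.
have hm : Num.max 0 (h 0) < m.
  by rewrite /m; have : Num.max 0 (h 0) < c by [rewrite gt_max c0]; lra.
have mc : m < c.
  by rewrite /m; have : Num.max 0 (h 0) < c by [rewrite gt_max c0]; lra.
move: hm; rewrite gt_max => /andP[m0 hm].
have U0 : U !=set0.
  exists (0, 0, z + m); rewrite /U/phi/=.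
  have -> : axis_dist (0, 0, z + m) = 0 :> R by rewrite /axis_dist/= expr0n/= addr0 sqrtr0.
  by rewrite hE0 addrAC subrr add0r gtr0_norm// subr_lt0 subr_gt0.
have [A [mA AU A0]] := open_contains_box _ oU U0.
have mD : measurable (lens h z) by exact: measurable_lens.
have mB : measurable (lens (hemisphere c) z).
  by apply: measurable_lens; exact: continuous_hemisphere.
have disj : lens h z `&` A = set0.
  apply/seteqP; split=> // p [pD /AU[]]; move: pD; rewrite /lens/phi/=; lra.
have AB : A `<=` lens (hemisphere c) z.
  by move=> p /AU[_]; rewrite /phi/lens/= subr_gt0.
rewrite -(ball_volume z c c0) -/mu.
have le : (mu (lens h z) + mu A <= mu (lens (hemisphere c) z))%E.
  rewrite -measureU//; apply: le_measure; rewrite ?inE//; first exact: measurableU.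
  by move=> p [/sub|/AB].
have fin : mu (lens h z) \is a fin_num.
  rewrite ge0_fin_numE//; apply: (@le_lt_trans _ _ (mu (lens (hemisphere c) z))).
    by apply: le_measure; rewrite ?inE.
  by rewrite /mu ball_volume// ltry.
by apply: lt_le_trans le; rewrite lteDl.
Qed.

(** * The volume of the drop *)

Theorem corollary4 (R : realType) (a b c0 : R) (M : set (R * R * R))
  (ha : 0 < a) (hb : 0 <= b)
  (hM : axisymmetric_closed_drop a b M)
  (hc0 : [set x : R | 0 < x /\ x * (a * x ^+ 2 + 2 * b) - 4 = 0] = [set c0]) :
  (enclosed_volume M < (4 / 3 * pi * c0 ^+ 3)%:E)%E.
Proof.
have [u0 [c [u [cpos [sol _] uc du ->]]]] := hM.
have rim := rim_equation a b u0 c u ha hb cpos sol du.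
have <- : c = c0.
  have : [set x : R | 0 < x /\ x * (a * x ^+ 2 + 2 * b) - 4 = 0] c.
    by split=> //; rewrite rim subrr.
  by rewrite hc0.
have c_ge0 := ltW cpos.
have ule := profile_le_rim a b u0 c u ha hb cpos sol uc.
have below := profile_below_sphere a b u0 c u ha hb cpos sol uc rim.
(* The depth below the rim, extended by 0 beyond [c] and constantly for [r < 0]. *)
pose h r := u c - u (clamp c r).
have ch : continuous h.
  move=> r; apply: cvgB; first exact: cvg_cst.
  apply: (continuous_clamp_comp c u c_ge0).
  exact: profile_continuous cpos sol uc.
have h0 r : c <= r -> h r = 0 by move=> cr; rewrite /h clamp_ge// subrr.
have hE r : 0 <= r <= c -> h r = u c - u r by move=> rc; rewrite /h clamp_id.
have hlt r : 0 <= r < c -> h r < hemisphere c r.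
  by move=> rc; rewrite hE ?below//; case/andP: rc => -> /ltW.
have hc r : h r <= c.
  have /andP[k0] := clamp_itv c r c_ge0.
  rewrite le_eqVlt => /orP[/eqP e|kc]; first by rewrite /h e subrr.
  apply: le_trans (ltW (below _ _)) _; first by rewrite k0.
  rewrite /hemisphere -[leRHS](gtr0_norm cpos) -sqrtr_sqr ler_sqrt ?sqr_ge0//.
  by rewrite gerBl sqr_ge0.
rewrite (drop_eq_lens_surface c u h ule hE) /enclosed_volume.
rewrite (enclosed_region_lens_surface h (u c) c ch h0 hc).
exact: lens_volume_lt.
Qed.
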